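(* There exists a presentation $G=\langle X\mid \mathcal{R}\rangle$ of a group $G$ of type $FP_2(\mathbb{Z})$ such that for any finite subset $T\subset \mathcal{R}$ there is a set $S$ with $T\subset S\subset \mathcal{R}$ such that the group $\langle X\mid S\rangle$ is not of type $FP_2(A)$ for any ring $A$.
   Context: Rings are nonzero with $1$. A group $G$ is of type $FP_n(A)$, for a ring $A$, if there is an exact sequence $P_n\to\dots\to P_1\to P_0\to A\to 0$ of projective $AG$-modules such that each $P_i$ is finitely generated, where $A$ is the trivial $AG$-module. *)

(* Defs.v *)
From HB Require Import structures.
From mathcomp Require Import all_boot all_order all_algebra.
From mathcomp Require Import generic_quotient finmap.
From mathcomp Require Import monalg.
From mathcomp Require Import boolp classical_sets cardinality.

Set Implicit Arguments.
Unset Strict Implicit.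
Unset Printing Implicit Defensive.

Import GRing.Theory.
Local Open Scope ring_scope.
Local Open Scope quotient_scope.

(* The group ring AG: finitely supported functions G -> A with convolution   *)
(* product.  monalg only makes {malg A[K]} a ring when K is a monoid without *)
(* nontrivial units, so the ring structure is put on an alias.               *)
Definition group_ring (A : nzRingType) (G : groupType) : Type := {malg A[G]}.

Section GroupRing.
Variables (A : nzRingType) (G : groupType).
Local Notation AG := (group_ring A G).

HB.instance Definition _ := GRing.Zmodule.copy AG {malg A[G]}.

Implicit Types x y z : {malg A[G]}.

Definition gr_one : {malg A[G]} := << 1 *g 1%g >>.

Definition gr_mul x y : {malg A[G]} :=
  \sum_(g <- msupp x) \sum_(h <- msupp y) << x@_g * y@_h *g (g * h)%g >>.

Let gr_mulw (d1 d2 : {fset G}) x y :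
    (msupp x `<=` d1)%fset -> (msupp y `<=` d2)%fset ->
  gr_mul x y = \sum_(g <- d1) \sum_(h <- d2) << x@_g * y@_h *g (g * h)%g >>.
Proof.
move=> le1 le2; rewrite /gr_mul (big_fset_incl _ le1) /=; last first.
  move=> g _ gx; rewrite big1 // => h _.
  by rewrite mcoeff_outdom // mul0r monalgU0.
apply: eq_bigr => g _; rewrite (big_fset_incl _ le2) //= => h _ hy.
by rewrite [y@_h]mcoeff_outdom // mulr0 monalgU0.
Qed.

Let gr_mulDl : left_distributive gr_mul +%R.
Proof.
move=> x y z.
rewrite (gr_mulw (msuppD_le x y) (fsubset_refl (msupp z))).
rewrite (gr_mulw (fsubsetUl (msupp x) (msupp y)) (fsubset_refl (msupp z))).
rewrite (gr_mulw (fsubsetUr (msupp x) (msupp y)) (fsubset_refl (msupp z))).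
rewrite -big_split /=; apply: eq_bigr => g _.
rewrite -big_split /=; apply: eq_bigr => h _.
by rewrite mcoeffD mulrDl monalgUD.
Qed.

Let gr_mulDr : right_distributive gr_mul +%R.
Proof.
move=> x y z.
rewrite (gr_mulw (fsubset_refl (msupp x)) (msuppD_le y z)).
rewrite (gr_mulw (fsubset_refl (msupp x)) (fsubsetUl (msupp y) (msupp z))).
rewrite (gr_mulw (fsubset_refl (msupp x)) (fsubsetUr (msupp y) (msupp z))).
rewrite -big_split /=; apply: eq_bigr => g _.
rewrite -big_split /=; apply: eq_bigr => h _.
by rewrite mcoeffD mulrDr monalgUD.
Qed.

Let gr_mul0l x : gr_mul 0 x = 0.
Proof. by rewrite /gr_mul msupp0 big_seq_fset0. Qed.

Let gr_mul0r x : gr_mul x 0 = 0.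
Proof. by rewrite /gr_mul msupp0 big1 // => g _; rewrite big_seq_fset0. Qed.

Let gr_mulUU a b g h :
  gr_mul << a *g g >> << b *g h >> = << a * b *g (g * h)%g >>.
Proof.
by rewrite (gr_mulw (@msuppU_le _ _ _ _) (@msuppU_le _ _ _ _))
  !big_seq_fset1 !mcoeffUU.
Qed.

Let gr_mul_suml I (r : seq I) (F : I -> {malg A[G]}) x :
  gr_mul (\sum_(i <- r) F i) x = \sum_(i <- r) gr_mul (F i) x.
Proof.
exact: (big_morph (gr_mul^~ x) (fun _ _ => gr_mulDl _ _ _) (gr_mul0l x)).
Qed.

Let gr_mul_sumr I (r : seq I) (F : I -> {malg A[G]}) x :
  gr_mul x (\sum_(i <- r) F i) = \sum_(i <- r) gr_mul x (F i).
Proof.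
exact: (big_morph (gr_mul x) (fun _ _ => gr_mulDr _ _ _) (gr_mul0r x)).
Qed.

Let gr_mul1l : left_id gr_one gr_mul.
Proof.
move=> x; rewrite [in LHS](monalgE x) gr_mul_sumr [RHS]monalgE.
by apply: eq_bigr => g _; rewrite gr_mulUU mul1r mul1g.
Qed.

Let gr_mul1r : right_id gr_one gr_mul.
Proof.
move=> x; rewrite [in LHS](monalgE x) gr_mul_suml [RHS]monalgE.
by apply: eq_bigr => g _; rewrite gr_mulUU mulr1 mulg1.
Qed.

Let gr_mulA : associative gr_mul.
Proof.
move=> x y z; rewrite (monalgE x) !gr_mul_suml; apply: eq_bigr => g _.
rewrite (monalgE y) gr_mul_suml !gr_mul_sumr gr_mul_suml.
apply: eq_bigr => h _.
rewrite (monalgE z) !gr_mul_sumr; apply: eq_bigr => k _.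
by rewrite !gr_mulUU mulrA mulgA.
Qed.

Let gr_one_neq0 : gr_one != 0.
Proof. by rewrite monalgU_eq0 oner_eq0. Qed.

HB.instance Definition _ := GRing.Zmodule_isNzRing.Build AG
  gr_mulA gr_mul1l gr_mul1r gr_mulDl gr_mulDr gr_one_neq0.

Definition augmentation (x : AG) : A := \sum_(g <- msupp x) x@_g.

Let augw (d : {fset G}) x :
  (msupp x `<=` d)%fset -> augmentation x = \sum_(g <- d) x@_g.
Proof.
move=> le; rewrite /augmentation (big_fset_incl _ le) //= => g _ gx.
by rewrite mcoeff_outdom.
Qed.

Lemma augmentationD (x y : AG) :
  augmentation (x + y) = augmentation x + augmentation y.
Proof.
rewrite (augw (msuppD_le x y)) (augw (fsubsetUl (msupp x) (msupp y))).
rewrite (augw (fsubsetUr (msupp x) (msupp y))) -big_split /=.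
by apply: eq_bigr => g _; rewrite mcoeffD.
Qed.

Lemma augmentationU (a : A) (g : G) : augmentation << a *g g >> = a.
Proof. by rewrite (augw (@msuppU_le _ _ _ _)) big_seq_fset1 mcoeffUU. Qed.

Lemma augmentation1 : augmentation 1 = 1.
Proof. exact: augmentationU. Qed.

Lemma augmentationM (x y : AG) :
  augmentation (x * y) = augmentation x * augmentation y.
Proof.
have aug0 : augmentation 0 = 0 by rewrite /augmentation msupp0 big_seq_fset0.
rewrite -[x * y]/(gr_mul x y) /gr_mul (big_morph _ augmentationD aug0).
rewrite mulr_suml; apply: eq_bigr => g _.
rewrite (big_morph _ augmentationD aug0) mulr_sumr; apply: eq_bigr => h _.
exact: augmentationU.
Qed.

End GroupRing.

(* A with G acting trivially, i.e. AG acts through the augmentation. *)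
Definition trivial_module (A : nzRingType) (G : groupType) : Type := A.

Section TrivialModule.
Variables (A : nzRingType) (G : groupType).
Local Notation AG := (group_ring A G).
Local Notation M := (trivial_module A G).

HB.instance Definition _ := GRing.Zmodule.copy M A.

Definition trivial_scale (x : AG) (a : M) : M := augmentation x * (a : A).

Let scaleA x y a :
  trivial_scale x (trivial_scale y a) = trivial_scale (x * y) a.
Proof. by rewrite /trivial_scale augmentationM mulrA. Qed.

Let scale1 : left_id 1 trivial_scale.
Proof. by move=> a; rewrite /trivial_scale augmentation1 mul1r. Qed.

Let scaleDr : right_distributive trivial_scale +%R.
Proof. by move=> x a b; exact: mulrDr. Qed.

Let scaleDl a : {morph trivial_scale^~ a : x y / x + y}.
Proof. by move=> x y; rewrite /trivial_scale augmentationD mulrDl. Qed.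

HB.instance Definition _ := GRing.Zmodule_isLmodule.Build AG M
  scaleA scale1 scaleDr scaleDl.

End TrivialModule.

Section Modules.
Variable R : nzRingType.

Definition finitely_generated (M : lmodType R) : Prop :=
  exists (k : nat) (e : 'I_k -> M), forall m : M,
    exists c : 'I_k -> R, m = \sum_(i < k) c i *: e i.

Definition projective (M : lmodType R) : Prop :=
  forall (N Q : lmodType R) (p : {linear N -> Q}) (f : {linear M -> Q}),
    (forall q : Q, exists n : N, p n = q) ->
    exists h : {linear M -> N}, forall m : M, p (h m) = f m.

Definition exact_at (L M N : lmodType R)
    (f : {linear L -> M}) (g : {linear M -> N}) : Prop :=
  forall m : M, g m = 0 <-> exists l : L, f l = m.

End Modules.

(* Only P 0, ..., P n and the maps between them matter; exactness is not     *)
(* required at P n.                                                          *)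
Definition type_FP (n : nat) (A : nzRingType) (G : groupType) : Prop :=
  exists (P : nat -> lmodType (group_ring A G))
         (d : forall i, {linear P i.+1 -> P i})
         (eps : {linear P 0%N -> trivial_module A G}),
    [/\ forall i, (i <= n)%N -> finitely_generated (P i) /\ projective (P i),
        forall a : trivial_module A G, exists x : P 0%N, eps x = a,
        (0 < n)%N -> exact_at (d 0%N) eps
      & forall i, (i.+1 < n)%N -> exact_at (d i.+1) (d i)].

(* The letter (x, true) stands for x and (x, false) for its inverse. *)
Definition word (X : choiceType) : Type := seq (X * bool).
HB.instance Definition _ (X : choiceType) := Choice.copy (word X) (seq (X * bool)).

Section Presentation.
Variable X : choiceType.

Definition inv_letter (l : X * bool) : X * bool := (l.1, ~~ l.2).
Definition inv_word (w : word X) : word X := rev (map inv_letter w).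

Variable R : set (word X).

Inductive pres_eq : word X -> word X -> Prop :=
| pres_refl u : pres_eq u u
| pres_sym u v : pres_eq u v -> pres_eq v u
| pres_trans v u w : pres_eq u v -> pres_eq v w -> pres_eq u w
| pres_cat u u' v v' : pres_eq u u' -> pres_eq v v' ->
    pres_eq (u ++ v) (u' ++ v')
| pres_cancel l : pres_eq [:: l; inv_letter l] [::]
| pres_relator r : R r -> pres_eq r [::].

Definition pres_rel : rel (word X) := fun u v => `[< pres_eq u v >].

Let pres_rel_refl : reflexive pres_rel.
Proof. by move=> u; apply/asboolP; exact: pres_refl. Qed.

Let pres_rel_sym : symmetric pres_rel.
Proof. by move=> u v; apply/asboolP/asboolP; exact: pres_sym. Qed.

Let pres_rel_trans : transitive pres_rel.
Proof. by move=> v u w /asboolP uv /asboolP vw; apply/asboolP/(pres_trans uv). Qed.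

Canonical pres_equiv := EquivRel pres_rel pres_rel_refl pres_rel_sym pres_rel_trans.

(* The group < X | R >.  X is arbitrary here, but presentations of groups of *)
(* type FP_n are meant with X finite: if X is infinite and S is a finite set *)
(* of relators, then < X | S > has a free factor of infinite rank, hence is  *)
(* not even of type FP_1 over any ring.                                      *)
Definition presented : Type := {eq_quot pres_equiv}.

HB.instance Definition _ := Choice.copy presented {eq_quot pres_equiv}.

Definition pres_class (w : word X) : presented := \pi_{eq_quot pres_equiv} w.
Definition pres_repr (a : presented) : word X := repr (a : {eq_quot pres_equiv}).

Lemma pres_classP (u v : word X) : pres_class u = pres_class v <-> pres_eq u v.
Proof.
split=> [/eqmodP/asboolP //|uv].
by apply/eqmodP/asboolP.
Qed.

Lemma pres_reprK : cancel pres_repr pres_class.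
Proof. exact: reprK. Qed.

Lemma pres_reprE (w : word X) : pres_eq (pres_repr (pres_class w)) w.
Proof. by apply/pres_classP; rewrite pres_reprK. Qed.

Let pres_eq_mulVw w : pres_eq (inv_word w ++ w) [::].
Proof.
elim: w => [|l w IHw]; first exact: pres_refl.
rewrite /inv_word /= rev_cons cat_rcons -/(inv_word w).
apply: pres_trans IHw; apply: (pres_cat (pres_refl _)).
rewrite -[[:: _, _ & _]]/([:: inv_letter l; l] ++ w) -[X in pres_eq _ X]cat0s.
apply: (pres_cat _ (pres_refl _)); have := pres_cancel (inv_letter l).
by rewrite {2}/inv_letter /= negbK -surjective_pairing.
Qed.

Let pres_eq_mulwV w : pres_eq (w ++ inv_word w) [::].
Proof.
have invK : inv_word (inv_word w) = w.
  rewrite /inv_word map_rev revK -map_comp map_id_in // => -[x b] _.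
  by rewrite /= /inv_letter /= negbK.
by have := pres_eq_mulVw (inv_word w); rewrite invK.
Qed.

Definition pres_one : presented := pres_class [::].
Definition pres_mul (a b : presented) := pres_class (pres_repr a ++ pres_repr b).
Definition pres_inv (a : presented) := pres_class (inv_word (pres_repr a)).

Lemma pres_class_cat u v :
  pres_class (u ++ v) = pres_mul (pres_class u) (pres_class v).
Proof.
by apply/pres_classP/pres_sym/pres_cat; exact: pres_reprE.
Qed.

Let pres_mulA : associative pres_mul.
Proof.
move=> a b c; rewrite -[a]pres_reprK -[b]pres_reprK -[c]pres_reprK.
by rewrite -!pres_class_cat catA.
Qed.

Let pres_mul1l : left_id pres_one pres_mul.
Proof. by move=> a; rewrite -[a]pres_reprK -pres_class_cat. Qed.

Let pres_mul1r : right_id pres_one pres_mul.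
Proof. by move=> a; rewrite -[a]pres_reprK -pres_class_cat cats0. Qed.

Let pres_mulVl : left_inverse pres_one pres_inv pres_mul.
Proof.
move=> a; rewrite -{2}[a]pres_reprK -pres_class_cat.
exact/pres_classP/pres_eq_mulVw.
Qed.

Let pres_mulVr : right_inverse pres_one pres_inv pres_mul.
Proof.
move=> a; rewrite -{1}[a]pres_reprK -pres_class_cat.
exact/pres_classP/pres_eq_mulwV.
Qed.

HB.instance Definition _ := isGroup.Build presented
  pres_mulA pres_mul1l pres_mul1r pres_mulVl pres_mulVr.

End Presentation.

(* Main.v *)
Require Import Defs.
From HB Require Import structures.
From mathcomp Require Import all_boot all_order all_algebra.
From mathcomp Require Import finmap monalg.
From mathcomp Require Import boolp classical_sets cardinality.

(** Let H be a finitely presented group containing perfect subgroups P_n,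
    n : nat, and let K be the normal subgroup that they generate.  As K is
    perfect, killing it adds nothing to the relation module of H, so H / K is
    still of type FP_2 over the integers.  In the presentation that adds the
    relators of all the P_n to those of H, one can then choose to kill only an
    abelian part of most of the P_n, and this makes the relation module too
    large to be finitely generated.

    The construction mixes Steinberg groups with three colours a, b, c.  A set
    of colours is thought of as the product of commuting idempotents attached
    to its elements, so that x^d_ij stands for the elementary matrix with the
    idempotent of the set d in position (i, j); index 0 only ever labels a
    column, hence the entries in column 0 form a module for the others.  The
    group H has the Steinberg relations between x^d and x^e as long as d and e
    together miss a colour, and two commuting elements s and t such that t
    commutes with x^a, s commutes with x^b, and s^-1 t commutes with x^c.  For
    every n there is then a second system of elements that satisfies the same
    Steinberg relations: x^a and x^b are unchanged, and x^c is conjugated by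
    s^n or, equivalently, by t^n.  Indeed a relation without a, without b or
    without c only sees the effect of a simultaneous conjugation by s^n, t^n
    or 1.  On the other hand, the commutator of x^a with the conjugate of x^bc
    involves all three colours and depends on n.  The group P_n generated by
    these commutators is perfect, because the relations that miss a colour
    suffice to see that its generators multiply like elementary matrices with
    an idempotent coefficient ([full_family_perfect]).

    Over any ring, FP_2 amounts to the Fox derivatives of the relators being
    spanned by finitely many of them: the Fox derivatives span the kernel of
    the boundary map ([ker_boundary]), and finite generation of this kernel
    does not depend on the resolution ([kernel_finitely_generated]).  A
    commutator of two relators has zero Fox derivative, which gives FP_2 for
    H / K ([all_relators_type_FP2]).

    To refute FP_2 it suffices to find, for any finite set L of relators, an
    integer valued cocycle that vanishes on L and takes the value 1 on some
    other relator ([cocycle_not_type_FP2]); the value 1 survives in every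
    nonzero ring.  Here s and t act as translations of the plane Z x Z, and
    the colours a, b and c become the indicator functions of the lines x = 0,
    y = 0 and x + y = - m.  Conjugating by s^n moves the third line, and the
    three lines have a common point only if n = m.  So P_n acts trivially
    unless n = m, whereas P_m acts by elementary matrices at the origin.  For
    a given finite set of relators, m is taken larger than all the levels n
    that occur in it ([intermediate_not_type_FP2]). *)

Set Implicit Arguments.
Unset Strict Implicit.
Unset Printing Implicit Defensive.

Import GRing.Theory.
Local Open Scope ring_scope.
Local Open Scope classical_set_scope.

(** * Families of group elements with Steinberg relations *)

Section SteinbergFamilies.
Local Open Scope group_scope.
Variable G : groupType.
Notation family := ('I_6 -> 'I_6 -> G).
Implicit Types f g h k m q : family.

(** Choosing a middle index that avoids 0, the two indices of each of two
    entries, or a previous middle index, is what six indices are for. *)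
Lemma fresh_index (s : seq 'I_6) : (size s < 6)%N -> exists n, n \notin s.
Proof.
move=> s_lt; apply/existsP; apply: contraTT s_lt => /existsPn s_full.
have: (#|'I_6| <= #|s|)%N.
  apply/subset_leq_card/fintype.subsetP => n _.
  by have := s_full n; rewrite negbK.
by rewrite card_ord -leqNgt => /leq_trans -> //; exact: card_size.
Qed.

(** This is the Hall-Witt identity for elements that satisfy enough commutation
    to make it look like the associativity of a product. *)
Lemma commg_assoc (x y z : G) :
    commute x z -> commute [~ x, y] x -> commute [~ x, y] [~ y, z] ->
  [~ [~ x, y], z] = [~ x, [~ y, z]].
Proof.
set w := [~ x, y]; set u := [~ y, z] => xz wx wu.
have wxu : commute w [~ x, u].
  rewrite /commg /conjg.
  by do 3?[apply: commuteM] => //; apply: commuteV.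
have zyV : y^-1 * z * y = z * u^-1.
  by rewrite invgR /commg /conjg !mulgA mulgV mul1g.
apply: (mulgI (z * w)); rewrite -(commgC w z) -(mulgA z) wxu.
have -> : [~ x, u] * w = x^-1 * u^-1 * x * (w * u).
  by rewrite wu /commg /conjg !mulgA.
have -> : w * z = x^-1 * (y^-1 * z * y) * (x * (w * u)).
  have -> : w * z = x^-1 * y^-1 * (x * (y * z)).
    by rewrite /w /commg /conjg !mulgA.
  rewrite (commgC y z) -/u !mulgA -(mulgA _ x z) xz !mulgA -(mulgA _ x y).
  by rewrite (commgC x y) -/w !mulgA.
have zxV : x^-1 * z = z * x^-1 by apply: commute_sym; apply: commuteV.
by rewrite zyV !mulgA zxV.
Qed.

(** Index 0 is kept out of the rows: the entries in column 0 will generate an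
    abelian normal subgroup. *)
Definition commuting f g := forall i j k l : 'I_6, i != ord0 -> k != ord0 ->
  i != j -> k != l -> i != l -> j != k -> commute (f i j) (g k l).

Definition composing f g h := forall i j l : 'I_6, i != ord0 -> j != ord0 ->
  i != j -> j != l -> i != l -> [~ f i j, g j l] = h i l.

Lemma commuting_sym f g : commuting f g -> commuting g f.
Proof.
move=> fg i j k l i0 k0 ij kl il jk; apply: commute_sym.
by apply: fg; rewrite // eq_sym.
Qed.

(** Each [h i j] is a commutator through a middle index that can be chosen away
    from the other indices, so that both of its factors commute with [k]. *)
Lemma composing_commuting f g h k :
  composing f g h -> commuting f k -> commuting g k -> commuting h k.
Proof.
move=> fgh fk gk i j u v i0 u0 ij uv iv ju.
have [n] := @fresh_index [:: ord0; i; j; u; v] isT.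
rewrite !inE !negb_or => /and5P[n0 ni nj nu nv].
have in_ : i != n by rewrite eq_sym.
rewrite -(fgh i n j) //; apply: commute_sym.
rewrite /commg /conjg; have fC := commute_sym (fk _ _ _ _ i0 u0 in_ uv iv nu).
have gC := commute_sym (gk _ _ _ _ n0 u0 nj uv nv ju).
by do 3?[apply: commuteM] => //; apply: commuteV.
Qed.

Lemma composing_assoc_at f g k h m :
    composing f g h -> composing g k m ->
    commuting f k -> commuting h m -> commuting h f ->
  forall i j n l, i != ord0 -> j != ord0 -> n != ord0 -> i != j -> j != l ->
    i != n -> n != l -> i != l -> j != n -> [~ h i j, k j l] = [~ f i n, m n l].
Proof.
move=> fgh gkm fk hm hf i j n l i0 j0 n0 ij jl in_ nl il jn.
have nj : n != j by rewrite eq_sym.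
rewrite -(fgh i n j) // -(gkm n j l) //; apply: commg_assoc.
- exact: fk.
- by rewrite fgh //; apply: hf => //; rewrite eq_sym.
- by rewrite fgh ?gkm //; apply: hm.
Qed.

Lemma composing_assoc f g k h m :
    composing f g h -> composing g k m ->
    commuting f k -> commuting h m -> commuting h f ->
  forall q, composing h k q <-> composing f m q.
Proof.
move=> fgh gkm fk hm hf q; have main := composing_assoc_at fgh gkm fk hm hf.
split=> Q i j l i0 j0 ij jl il.
- have [n] := @fresh_index [:: ord0; i; j; l] isT.
  rewrite !inE !negb_or => /and4P[n0 ni nj nl].
  by rewrite -(main i n j l) ?Q // eq_sym.
- have [n] := @fresh_index [:: ord0; i; j; l] isT.
  rewrite !inE !negb_or => /and4P[n0 ni nj nl].
  by rewrite (main i j n l) ?Q // eq_sym.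
Qed.

(** The commutators [~ h i n, k n l] do not depend on the middle index [n]: by
    [composing_assoc_at] they equal [~ f i p, m p l] for any other [p]. *)
Lemma composing_exists f g k h m :
    composing f g h -> composing g k m ->
    commuting f k -> commuting h m -> commuting h f ->
  exists q, composing h k q.
Proof.
move=> fgh gkm fk hm hf; have main := composing_assoc_at fgh gkm fk hm hf.
exists (fun i l =>
  if [pick n | n \notin [:: ord0; i; l]] is Some n
  then [~ h i n, k n l] else 1).
move=> i j l i0 j0 ij jl il; case: pickP => [n | none]; last first.
  have [n n_new] := @fresh_index [:: ord0; i; l] isT.
  by have := none n; rewrite n_new.
rewrite !inE !negb_or => /and3P[n0 ni nl].
have [p] := @fresh_index [:: ord0; i; j; l; n] isT.
rewrite !inE !negb_or => /and5P[p0 pi pj pl pn].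
by rewrite (main i j p l) ?(main i n p l) // eq_sym.
Qed.

(** The three bits tell which of the colours a, b, c belong to the set. *)
Definition colour := (bool * bool * bool)%type.
Definition join (s t : colour) : colour :=
  (s.1.1 || t.1.1, s.1.2 || t.1.2, s.2 || t.2).
Definition full : colour := (true, true, true).

(** This is where perfectness comes from.  Only pairs of colour sets missing a
    colour are related, yet the three-coloured commutators [q] are well defined
    and idempotent.  Associativity moves one colour at a time: first [q] is
    identified with the product of the three colours in several orders, then it
    absorbs each single colour, hence also [bc], and finally itself. *)
Lemma full_family_perfect (x : colour -> family) :
    (forall s t, join s t != full -> commuting (x s) (x t)) ->
    (forall s t, join s t != full -> composing (x s) (x t) (x (join s t))) ->
  exists q, [/\ composing (x (true, false, false)) (x (false, true, true)) q
              & composing q q q].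
Proof.
pose a : colour := (true, false, false).
pose b : colour := (false, true, false).
pose c : colour := (false, false, true).
pose ab : colour := (true, true, false).
pose bc : colour := (false, true, true).
pose ac : colour := (true, false, true).
move=> C M; rewrite -/a -/bc.
have := (M a b isT, M b a isT, M b c isT, M a c isT, M c a isT).
rewrite /join /= -/ab -/ac -/bc => -[[[[Mab Mba] Mbc] Mac] Mca].
have := (M a a isT, M b b isT, M c c isT).
rewrite /join /= -/a -/b -/c => -[[Maa Mbb] Mcc].
have C_bc_a : commuting (x bc) (x a).
  by apply: (composing_commuting Mbc); apply: C.
have C_ac_b : commuting (x ac) (x b).
  by apply: (composing_commuting Mac); apply: C.
have C_ab_c : commuting (x ab) (x c).
  by apply: (composing_commuting Mab); apply: C.
have C_ab_bc : commuting (x ab) (x bc).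
  by apply: (composing_commuting Mab); [apply: commuting_sym | apply: C].
have C_ab_ac : commuting (x ab) (x ac).
  by apply: (composing_commuting Mab); [apply: C | apply: commuting_sym].
have C_ac_bc : commuting (x ac) (x bc).
  by apply: (composing_commuting Mac); [apply: commuting_sym | apply: C].
have [q abcq] : exists q, composing (x ab) (x c) q.
  by apply: (composing_exists Mab Mbc) => //; apply: C.
have a_bc : composing (x a) (x bc) q.
  exact/(composing_assoc Mab Mbc (C a c isT) C_ab_bc (C ab a isT)).
have b_ac : composing (x b) (x ac) q.
  exact/(composing_assoc Mba Mac (C b c isT) C_ab_ac (C ab b isT)).
have c_ab : composing (x c) (x ab) q.
  have C_ca := C ac c isT; apply/(composing_assoc Mca Mab (C c b isT) _ C_ca).
    exact: commuting_sym.
  exact/(composing_assoc Mac (M c b isT) (C a b isT) C_ac_bc (C ac a isT)).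
have q_a : commuting q (x a) := composing_commuting a_bc (C a a isT) C_bc_a.
have q_b : commuting q (x b) := composing_commuting b_ac (C b b isT) C_ac_b.
have q_c : commuting q (x c) := composing_commuting c_ab (C c c isT) C_ab_c.
have q_bc : commuting q (x bc).
  apply: commuting_sym.
  by apply: (composing_commuting Mbc); apply: commuting_sym.
have q_q : commuting q q.
  by apply: (composing_commuting a_bc); apply: commuting_sym.
have aq : composing (x a) q q.
  have [q_a' C_bc_a'] := (commuting_sym q_a, commuting_sym C_bc_a).
  exact/(composing_assoc Maa a_bc C_bc_a' q_a' (C a a isT)).
have bq : composing (x b) q q.
  have [q_b' C_ac_b'] := (commuting_sym q_b, commuting_sym C_ac_b).
  exact/(composing_assoc Mbb b_ac C_ac_b' q_b' (C b b isT)).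
have cq : composing (x c) q q.
  have [q_c' C_ab_c'] := (commuting_sym q_c, commuting_sym C_ab_c).
  exact/(composing_assoc Mcc c_ab C_ab_c' q_c' (C c c isT)).
have bcq : composing (x bc) q q.
  have [q_b' q_bc'] := (commuting_sym q_b, commuting_sym q_bc).
  exact/(composing_assoc Mbc cq q_b' q_bc' (C bc b isT)).
exists q; split=> //.
exact/(composing_assoc a_bc bcq (commuting_sym q_a) q_q q_a).
Qed.
End SteinbergFamilies.

(** * Spans and free modules *)

Section Span.
Variables (R : nzRingType) (M : lmodType R).
Implicit Types (B : set M) (u v : M).

Definition span B : set M := [set v | exists s : seq (R * M),
  (forall p, p \in s -> B p.2) /\ v = \sum_(p <- s) p.1 *: p.2].

Lemma span0 B : span B 0.
Proof. by exists [::]; rewrite big_nil. Qed.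

Lemma spanD B u v : span B u -> span B v -> span B (u + v).
Proof.
move=> [s [sB ->]] [t [tB ->]]; exists (s ++ t); rewrite big_cat; split=> // p.
by rewrite mem_cat => /orP[/sB|/tB].
Qed.

Lemma spanZ B a v : span B v -> span B (a *: v).
Proof.
move=> [s [sB ->]]; exists [seq (a * p.1, p.2) | p <- s]; split.
  by move=> _ /mapP[p /sB Bp ->].
by rewrite big_map scaler_sumr; apply: eq_bigr => p _; rewrite scalerA.
Qed.

Lemma spanN B v : span B v -> span B (- v).
Proof. by rewrite -scaleN1r; exact: spanZ. Qed.

Lemma span_sum B (I : Type) (r : seq I) (F : I -> M) :
  (forall i, span B (F i)) -> span B (\sum_(i <- r) F i).
Proof. by move=> BF; apply: big_ind => //; [exact: span0 | exact: spanD]. Qed.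

Lemma sub_span B : B `<=` span B.
Proof.
move=> v Bv; exists [:: (1, v)]; rewrite big_seq1 scale1r.
by split=> // p; rewrite inE => /eqP->.
Qed.

Lemma span_sub B C : B `<=` span C -> span B `<=` span C.
Proof.
move=> BC _ [s [sB ->]]; rewrite big_seq; apply: big_ind => [||p ps].
- exact: span0.
- exact: spanD.
- by apply: spanZ; apply: BC; apply: sB.
Qed.

Definition lincomb n (e : 'I_n -> M) (c : 'rV[R]_n) : M := \sum_i c 0 i *: e i.

Lemma lincomb_is_linear n (e : 'I_n -> M) : linear (lincomb e).
Proof.
move=> a u v; rewrite /lincomb scaler_sumr -big_split; apply: eq_bigr => i _ /=.
by rewrite !mxE scalerDl scalerA.
Qed.

HB.instance Definition _ n (e : 'I_n -> M) :=
  GRing.isLinear.Build R 'rV[R]_n M _ (lincomb e) (lincomb_is_linear e).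

Lemma lincomb_delta n (e : 'I_n -> M) i : lincomb e (delta_mx 0 i) = e i.
Proof.
rewrite /lincomb (bigD1 i) //= mxE !eqxx scale1r big1 ?addr0 // => j ji.
by rewrite mxE eqxx (negPf ji) scale0r.
Qed.

Lemma span_lincomb n (e : 'I_n -> M) v :
  span (range e) v <-> exists c, lincomb e c = v.
Proof.
split=> [[s [se ->]] | [c <-]]; last first.
  by apply: span_sum => i; apply/spanZ/sub_span; exists i.
elim: s se => [|p s IHs] se; first by exists 0; rewrite linear0 big_nil.
have [i _ pi] := se p (mem_head _ _).
have [c cs] := IHs (fun q qs => se q (mem_behead (s := p :: s) qs)).
exists (p.1 *: delta_mx 0 i + c).
by rewrite linearD linearZ /= lincomb_delta pi cs big_cons.
Qed.
End Span.

Section FreeModules.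
Variables (R : nzRingType) (n : nat).

Lemma lincomb_id (v : 'rV[R]_n) : lincomb (fun i => delta_mx 0 i) v = v.
Proof. by rewrite [RHS]row_sum_delta. Qed.

Lemma free_finitely_generated : finitely_generated ('rV[R]_n : lmodType R).
Proof.
exists n, (fun i => delta_mx 0 i) => v; exists (v 0).
by rewrite -[LHS]lincomb_id.
Qed.

Lemma linear_lincomb (M : lmodType R) (f : {linear 'rV[R]_n -> M}) v :
  f v = lincomb (fun i => f (delta_mx 0 i)) v.
Proof.
by rewrite -{1}[v]lincomb_id linear_sum; apply: eq_bigr => i _; rewrite linearZ.
Qed.

Lemma free_projective : projective ('rV[R]_n : lmodType R).
Proof.
move=> N Q p f p_surj.
have [e pe] := choice (fun i : 'I_n => p_surj (f (delta_mx 0 i))).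
exists (lincomb e : {linear 'rV[R]_n -> N}) => v.
rewrite linear_sum linear_lincomb.
by apply: eq_bigr => i _; rewrite linearZ /= pe.
Qed.
End FreeModules.

(** * Group rings and Fox derivatives *)

Lemma pres_eq_sub (X : choiceType) (B C : set (word X)) u v :
  B `<=` C -> pres_eq B u v -> pres_eq C u v.
Proof.
move=> BC; elim=> {u v} [u|u v _|v u w _ uv _|u u' v v' _ uu' _|l|r /BC].
- exact: pres_refl.
- exact: pres_sym.
- exact: pres_trans.
- exact: pres_cat.
- exact: pres_cancel.
- exact: pres_relator.
Qed.

Section GroupRing.
Variables (A : nzRingType) (G : groupType).
Implicit Types (a b : A) (g h : G).

Definition gr_single a g : group_ring A G := << a *g g >>.

Lemma gr_singleM a b g h :
  gr_single a g * gr_single b h = gr_single (a * b) (g * h)%g.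
Proof.
rewrite -[LHS]/(gr_mul _ _) /gr_mul /gr_single !msuppU.
have [->|a0] := eqVneq a 0; first by rewrite mul0r big_seq_fset0 monalgU0.
rewrite big_seq_fset1.
have [->|b0] := eqVneq b 0; first by rewrite mulr0 big_seq_fset0 monalgU0.
by rewrite big_seq_fset1 !mcoeffUU.
Qed.

Lemma gr_single1 : gr_single 1 1%g = 1.
Proof. by []. Qed.

Lemma gr_singleB a b g : gr_single (a - b) g = gr_single a g - gr_single b g.
Proof. exact: monalgUB. Qed.

Lemma gr_single_sum (I : Type) (r : seq I) (f : I -> A) g :
  gr_single (\sum_(i <- r) f i) g = \sum_(i <- r) gr_single (f i) g.
Proof.
exact: (big_morph (gr_single^~ g) (monalgUD g) (monalgU0 g)).
Qed.

Lemma gr_expand (x : group_ring A G) : x = \sum_(g <- msupp x) gr_single x@_g g.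
Proof. exact: monalgE. Qed.

Section Extension.
Variables (V : zmodType) (F : G -> {additive A -> V}).

Definition gr_extension (x : group_ring A G) : V :=
  \sum_(g <- msupp x) F g x@_g.

Lemma gr_extension_incl (D : {fset G}) (x : group_ring A G) :
  (msupp x `<=` D)%fset -> gr_extension x = \sum_(g <- D) F g x@_g.
Proof.
move=> le; rewrite /gr_extension (big_fset_incl _ le) //= => g _ gx.
by rewrite mcoeff_outdom // raddf0.
Qed.

Lemma gr_extensionB x y :
  gr_extension (x - y) = gr_extension x - gr_extension y.
Proof.
rewrite (gr_extension_incl (msuppB_le x y)).
rewrite (gr_extension_incl (fsubsetUl (msupp x) (msupp y))).
rewrite (gr_extension_incl (fsubsetUr (msupp x) (msupp y))) -sumrB.
by apply: eq_bigr => g _; rewrite mcoeffB raddfB.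
Qed.

HB.instance Definition _ :=
  GRing.isZmodMorphism.Build (group_ring A G) V gr_extension gr_extensionB.

Lemma gr_extension_single a g : gr_extension (gr_single a g) = F g a.
Proof. by rewrite (gr_extension_incl msuppU_le) big_seq_fset1 mcoeffUU. Qed.
End Extension.

Variables (M : lmodType (group_ring A G)) (v : M).

Definition coeff_scale a : M := gr_single a 1%g *: v.

Lemma coeff_scaleB a b : coeff_scale (a - b) = coeff_scale a - coeff_scale b.
Proof. by rewrite /coeff_scale gr_singleB scalerBl. Qed.

HB.instance Definition _ :=
  GRing.isZmodMorphism.Build A M coeff_scale coeff_scaleB.
End GroupRing.

Section Fox.
Variables (X : finType) (A : nzRingType) (S : set (word X)).
Notation AG := (group_ring A (presented S)).
Local Notation cls := (@pres_class X S).
Local Notation "[ a , g ]" := (@gr_single A (presented S) a g).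

Lemma pres_class_cons l (w : word X) : cls (l :: w) = (cls [:: l] * cls w)%g.
Proof. by rewrite -[l :: w]/([:: l] ++ w) pres_class_cat. Qed.

Lemma pres_class_catg (u v : word X) : cls (u ++ v) = (cls u * cls v)%g.
Proof. exact: pres_class_cat. Qed.

Lemma pres_class_cancel l : (cls [:: l] * cls [:: inv_letter l])%g = 1%g.
Proof. by rewrite -pres_class_catg; apply/pres_classP/pres_cancel. Qed.

Lemma pres_class_inv (w : word X) : cls (inv_word w) = (cls w)^-1%g.
Proof.
elim: w => [|l w IHw]; first by rewrite invg1.
rewrite /inv_word /= rev_cons -cats1 -/(inv_word w) pres_class_catg IHw.
rewrite (pres_class_cons l w) invgM; congr (_ * _)%g.
by apply/esym/mulg1_eq/pres_class_cancel.
Qed.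

(** The derivation is defined for an arbitrary target, which gives at once the
    Fox derivatives in the free module and their images under linear maps. *)
Section Derivation.
Variables (M : lmodType AG) (e : X -> M).

Definition fox_letter (l : X * bool) : M :=
  if l.2 then e l.1 else - ([1, cls [:: l]] *: e l.1).

Fixpoint fox (w : word X) : M :=
  if w is l :: w' then fox_letter l + [1, cls [:: l]] *: fox w' else 0.

Lemma fox1 x : fox [:: (x, true)] = e x.
Proof. by rewrite /= scaler0 addr0. Qed.

Lemma fox_cat u v : fox (u ++ v) = fox u + [1, cls u] *: fox v.
Proof.
elim: u => [|l u IHu] /=; first by rewrite add0r gr_single1 scale1r.
rewrite IHu scalerDr scalerA gr_singleM mulr1 addrA; congr (_ + _ *: _).
by rewrite (pres_class_cons l u).
Qed.

Lemma fox_cancel l : fox [:: l; inv_letter l] = 0.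
Proof.
rewrite /= scaler0 addr0 /fox_letter; case: l => x [] /=.
  rewrite scalerN scalerA gr_singleM mulr1.
  by rewrite (pres_class_cancel (x, true)) gr_single1 scale1r addrN.
by rewrite addNr.
Qed.

Lemma fox_inv w : fox (inv_word w) = - ([1, (cls w)^-1%g] *: fox w).
Proof.
elim: w => [|l w IHw]; first by rewrite /= scaler0 oppr0.
rewrite /inv_word /= rev_cons -cats1 -/(inv_word w) fox_cat IHw pres_class_inv.
have -> : fox [:: inv_letter l] = - ([1, (cls [:: l])^-1%g] *: fox [:: l]).
  have := fox_cancel l.
  rewrite -[[:: l; _]]/([:: l] ++ [:: inv_letter l]) fox_cat.
  move/(congr1 (fun v => [1, (cls [:: l])^-1%g] *: v)).
  rewrite scalerDr scalerA gr_singleM mulr1 mulVg gr_single1 scale1r scaler0.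
  by move/eqP; rewrite addrC addr_eq0 => /eqP.
have -> : fox [:: l] = fox_letter l by rewrite /= scaler0 addr0.
rewrite (pres_class_cons l w) invgM scalerDr opprD scalerN !scalerA !gr_singleM.
by rewrite !mulr1 mulgVK addrC.
Qed.

Definition commutator_word (u v : word X) : word X :=
  inv_word u ++ inv_word v ++ u ++ v.

Lemma pres_class_commutator u v :
  cls (commutator_word u v) = [~ cls u, cls v]%g.
Proof. by rewrite !pres_class_catg !pres_class_inv. Qed.

(** Relators act trivially, so their commutators have no first order part. *)
Lemma fox_commutator u v : cls u = 1%g -> cls v = 1%g ->
  fox (commutator_word u v) = 0.
Proof.
move=> u1 v1; rewrite !fox_cat !fox_inv !pres_class_inv u1 v1 !invg1 gr_single1.
by rewrite !scale1r addrA -opprD [_ + fox v]addrC addNr.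
Qed.

Lemma fox_pres_eq (B : set (word X)) u v : B `<=` S -> pres_eq B u v ->
  span (fox @` B) (fox u - fox v).
Proof.
move=> BS uv; have sub_eq w w' (ww' : pres_eq B w w') : cls w = cls w'.
  exact/pres_classP/(pres_eq_sub BS).
elim: uv => {u v} [u|u v _ IH|v u w _ IH1 _ IH2|u u' v v' uu' IH1 _ IH2|l|r Br].
- by rewrite subrr; exact: span0.
- by rewrite -opprB; exact: spanN.
- by rewrite -(subrKA (fox v)); exact: spanD.
- rewrite !fox_cat (sub_eq _ _ uu') opprD addrACA -scalerBr.
  by apply: spanD => //; exact: spanZ.
- by rewrite fox_cancel subr0; exact: span0.
- by rewrite subr0; apply: sub_span; exists r.
Qed.

(** This additive map is a right inverse of the boundary map on the augmentation
    ideal; it is a left inverse only modulo Fox derivatives of relators, as it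
    depends on a choice of words representing the group elements. *)
Definition fox_lift : AG -> M :=
  gr_extension (fun g => coeff_scale (fox (pres_repr g))).
HB.instance Definition _ := GRing.Additive.on fox_lift.

Lemma fox_lift_single a g : fox_lift [a, g] = [a, 1%g] *: fox (pres_repr g).
Proof. exact: gr_extension_single. Qed.
End Derivation.

Lemma linear_fox (M N : lmodType AG) (f : {linear M -> N}) (e : X -> M) w :
  f (fox e w) = fox (f \o e) w.
Proof.
elim: w => [|l w IHw] /=; first by rewrite linear0.
rewrite linearD linearZ /= IHw /fox_letter.
by case: (l.2) => //; rewrite linearN linearZ.
Qed.
End Fox.

(** * Exactness of the Fox resolution *)

Section Regular.
Variable R : nzRingType.

Definition scale_at (M : lmodType R) (v : M) (a : R^o) : M := (a : R) *: v.

Lemma scale_at_is_linear (M : lmodType R) (v : M) : linear (scale_at v).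
Proof. by move=> a b c; rewrite /scale_at scalerDl scalerA. Qed.

HB.instance Definition _ (M : lmodType R) (v : M) :=
  GRing.isLinear.Build R R^o M _ (scale_at v) (scale_at_is_linear v).

Lemma regular_finitely_generated : finitely_generated (R^o : lmodType R).
Proof.
by exists 1%N, (fun=> 1) => m; exists (fun=> m); rewrite big_ord1 [RHS]mulr1.
Qed.

Lemma regular_projective : projective (R^o : lmodType R).
Proof.
move=> N Q p f p_surj; have [n pn] := p_surj (f 1).
exists (scale_at n : {linear R^o -> N}) => m; rewrite linearZ /= pn.
by rewrite -linearZ /=; congr (f _); exact: mulr1.
Qed.
End Regular.

Section Exactness.
Variables (X : finType) (A : nzRingType) (S : set (word X)).
Notation AG := (group_ring A (presented S)).
Local Notation "[ a , g ]" := (@gr_single A (presented S) a g).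
Local Notation cls := (@pres_class X S).

Lemma fox_augmentation (N : lmodType AG) (v : N) (w : word X) :
  fox (fun x => ([1, cls [:: (x, true)]] - 1) *: v) w = ([1, cls w] - 1) *: v.
Proof.
elim: w => [|l w IHw] /=; first by rewrite gr_single1 subrr scale0r.
rewrite IHw (pres_class_cons S l w) /fox_letter.
have -> : (if l.2 then ([1, cls [:: (l.1, true)]] - 1) *: v else
    - ([1, cls [:: l]] *: (([1, cls [:: (l.1, true)]] - 1) *: v))) =
    ([1, cls [:: l]] - 1) *: v.
  case: l => x [] //=.
  rewrite scalerA -scaleNr mulrBr mulr1 gr_singleM mulr1.
  by rewrite (pres_class_cancel _ (x, false)) gr_single1 opprB.
by rewrite scalerA -scalerDl mulrBr mulr1 gr_singleM mulr1 addrC subrKA.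
Qed.

Variables (M : lmodType AG) (e : X -> M).
Variable d : {linear M -> AG^o}.
Hypothesis d_gen : forall x, d (e x) = [1, cls [:: (x, true)]] - 1.

Lemma boundary_fox w : d (fox e w) = [1, cls w] - 1.
Proof.
rewrite linear_fox; have := fox_augmentation (1 : AG^o) w.
have -> : (fun x => ([1, cls [:: (x, true)]] - 1) *: (1 : AG^o)) = d \o e.
  by apply/funext => x /=; rewrite d_gen; exact: mulr1.
by move=> ->; exact: mulr1.
Qed.

Lemma boundary_fox_lift (x : AG) :
  d (fox_lift e x) = x - [augmentation x, 1%g].
Proof.
have augE : [augmentation x, 1%g] = \sum_(g <- msupp x) [x@_g, 1%g] :> AG.
  exact: gr_single_sum.
rewrite augE [X in X - _]gr_expand -sumrB linear_sum; apply: eq_bigr => g _.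
rewrite linearZ /= boundary_fox pres_reprK.
by rewrite -[LHS]/(_ * _) mulrBr mulr1 gr_singleM mulr1 mul1g.
Qed.

Hypothesis e_span : forall q, span (range e) q.

(** A generator [c *: e x] differs from the lift of its boundary by Fox
    derivatives of pairs of equivalent words; this extends to all of [M] by
    additivity. *)
Lemma ker_boundary q : d q = 0 -> span (fox e @` S) q.
Proof.
have expand_gen c x : span (fox e @` S) (c *: e x - fox_lift e (d (c *: e x))).
  rewrite linearZ /= d_gen [c *: (_ : AG^o)]mulrBr mulr1 raddfB /= [c]gr_expand.
  rewrite scaler_suml mulr_suml !(raddf_sum (fox_lift e)) -!sumrB.
  apply: span_sum => g; set a := c@_g.
  rewrite gr_singleM mulr1 /= !fox_lift_single.
  have -> : [a, g] = [a, 1%g] * [1, cls (pres_repr g)].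
    by rewrite gr_singleM mulr1 mul1g pres_reprK.
  rewrite -scalerA -!scalerBr opprB addrA [_ + fox e (pres_repr g)]addrC.
  rewrite -{1}(fox1 e x) -fox_cat.
  apply/spanZ/fox_pres_eq => //; apply/pres_classP.
  by rewrite pres_class_catg !pres_reprK.
move=> dq0; suff : span (fox e @` S) (q - fox_lift e (d q)).
  by rewrite dq0 raddf0 subr0.
have [s [se ->]] := e_span q; elim: s se => [|[c v] s IHs] se.
  by rewrite big_nil linear0 raddf0 subr0; exact: span0.
have [x _ /= <-] := se _ (mem_head _ _).
rewrite big_cons linearD raddfD /= opprD addrACA; apply: spanD => //.
by apply: IHs => p ps; apply: se; rewrite inE ps orbT.
Qed.
End Exactness.

(** * Finite generation of the relation module *)

Section Schanuel.
Variable R : nzRingType.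

(** Only the image of [f] has to be covered by [d].  A finitely generated
    projective module is a retract of a free one, and a map out of a free
    module is lifted on the basis. *)
Lemma projective_lift (M N N' : lmodType R) (d : {linear N -> N'})
    (f : {linear M -> N'}) :
    finitely_generated M -> projective M -> (forall m, exists n, d n = f m) ->
  exists h : {linear M -> N}, forall m, d (h m) = f m.
Proof.
move=> [k [e e_gen]] projM df.
have [s es] : exists s : {linear M -> 'rV[R]_k}, forall m, lincomb e (s m) = m.
  apply: (projM _ _ (lincomb e) idfun) => m; have [c ->] := e_gen m.
  by exists (\row_i c i); apply: eq_bigr => i _; rewrite mxE.
have [n dn] := choice (fun i => df (e i)).
exists (lincomb n \o s : {linear M -> N}) => m.
rewrite -{2}[m]es /= !linear_sum.
by apply: eq_bigr => i _; rewrite !linearZ dn.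
Qed.

(** The comparison maps of two resolutions compose to the identity up to a
    homotopy [h].  An element of the kernel of [b] is therefore the sum of an
    element of the image of [P2] and of a value of the defect [theta] of the
    homotopy, all values of which lie in that kernel. *)
Lemma kernel_finitely_generated (P2 P1 P0 Q1 Q0 T : lmodType R)
    (d1 : {linear P2 -> P1}) (d0 : {linear P1 -> P0}) (eps : {linear P0 -> T})
    (b : {linear Q1 -> Q0}) (eta : {linear Q0 -> T}) :
    finitely_generated P2 ->
    finitely_generated P1 -> projective P1 ->
    finitely_generated P0 -> projective P0 ->
    finitely_generated Q1 -> projective Q1 ->
    finitely_generated Q0 -> projective Q0 ->
    exact_at d1 d0 -> exact_at d0 eps -> exact_at b eta ->
    (forall t, exists x, eps x = t) -> (forall t, exists x, eta x = t) ->
  exists s : seq Q1, (forall v, v \in s -> b v = 0) /\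
    forall z, b z = 0 -> span [set` s] z.
Proof.
move=> fgP2 fgP1 prP1 fgP0 prP0 fgQ1 prQ1 fgQ0 prQ0 exP1 exP0 exQ0.
move=> eps_surj eta_surj.
have [f0 f0E] := projective_lift fgQ0 prQ0 (fun m => eps_surj (eta m)).
have [g0 g0E] := projective_lift fgP0 prP0 (fun m => eta_surj (eps m)).
have [f1 f1E] : exists f1 : {linear Q1 -> P1}, forall q, d0 (f1 q) = f0 (b q).
  apply: (projective_lift (f := f0 \o b) fgQ1 prQ1) => q; apply/exP0.
  by rewrite /= f0E; apply/exQ0; exists q.
have [g1 g1E] : exists g1 : {linear P1 -> Q1}, forall p, b (g1 p) = g0 (d0 p).
  apply: (projective_lift (f := g0 \o d0) fgP1 prP1) => p; apply/exQ0.
  by rewrite /= g0E; apply/exP0; exists p.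
have [h hE] : exists h : {linear Q0 -> Q1}, forall q, b (h q) = q - g0 (f0 q).
  apply: (projective_lift (f := idfun \- (g0 \o f0)) fgQ0 prQ0) => q.
  by apply/exQ0; rewrite /= linearB /= g0E f0E subrr.
pose theta : {linear Q1 -> Q1} := (idfun \- (g1 \o f1)) \- (h \o b).
have thetaE q : theta q = q - g1 (f1 q) - h (b q) by [].
have b_theta q : b (theta q) = 0.
  by rewrite thetaE !linearB /= g1E f1E hE subrr.
have [[k [p p_gen]] [l [q q_gen]]] := (fgP2, fgQ1).
exists ([seq theta (q i) | i : 'I_l] ++ [seq g1 (d1 (p i)) | i : 'I_k]); split.
  move=> v; rewrite mem_cat => /orP[] /mapP[i _ ->] //.
  have d01 : d0 (d1 (p i)) = 0 by apply/exP1; exists (p i).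
  by rewrite g1E d01 linear0.
move=> z bz0; have [y d1y] : exists y, d1 y = f1 z.
  by apply/exP1; rewrite f1E bz0 linear0.
have -> : z = theta z + g1 (d1 y).
  by rewrite thetaE bz0 linear0 subr0 d1y subrK.
apply: spanD.
  have [c ->] := q_gen z; rewrite linear_sum; apply: span_sum => i.
  rewrite linearZ; apply/spanZ/sub_span => /=.
  by rewrite mem_cat; apply/orP; left; apply/mapP; exists i; rewrite ?mem_enum.
have [c ->] := p_gen y; rewrite !linear_sum; apply: span_sum => i.
rewrite !linearZ; apply/spanZ/sub_span => /=.
by rewrite mem_cat; apply/orP; right; apply/mapP; exists i; rewrite ?mem_enum.
Qed.

Lemma span_image_finite (M : lmodType R) (W : eqType) (f : W -> M) (S : set W)
    (s : seq M) : (forall v, v \in s -> span (f @` S) v) ->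
  exists L : seq W, (forall w, w \in L -> S w) /\
    forall v, v \in s -> span (f @` [set` L]) v.
Proof.
elim: s => [|v s IHs] sS; first by exists [::].
have [L [LS Ls]] := IHs (fun u us => sS u (mem_behead (s := v :: s) us)).
have [t [tS ->]] := sS v (mem_head _ _).
have [K [KS Kt]] : exists K : seq W, (forall w, w \in K -> S w) /\
    forall p, p \in t -> (f @` [set` K]) p.2.
  elim: t tS => [|p t IHt] tS; first by exists [::].
  have [K [KS Kt]] := IHt (fun q qt => tS q (mem_behead (s := p :: t) qt)).
  have [w Sw wp] := tS p (mem_head _ _).
  exists (w :: K); split=> [u | q].
    by rewrite inE => /predU1P[->|/KS].
  rewrite inE => /predU1P[->|/Kt [u /= uK <-]].
    by exists w; rewrite /= ?mem_head.
  by exists u; rewrite //= inE uK orbT.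
exists (K ++ L); split=> [w | u].
  by rewrite mem_cat => /orP[/KS|/LS].
have incl (C : seq W) : {subset C <= K ++ L} ->
    f @` [set` C] `<=` f @` [set` K ++ L].
  by move=> CKL _ [w wC <-]; exists w => //; apply: CKL.
rewrite inE => /predU1P[->|/Ls].
  exists t; split=> // p /Kt; apply: incl => w wK; by rewrite mem_cat wK.
apply: span_sub => x xL; apply: sub_span; apply: incl xL => w wL.
by rewrite mem_cat wL orbT.
Qed.
End Schanuel.

Section Criterion.
Variables (X : finType) (A : nzRingType) (S : set (word X)).
Notation AG := (group_ring A (presented S)).
Local Notation "[ a , g ]" := (@gr_single A (presented S) a g).
Local Notation cls := (@pres_class X S).

Definition pres_gen (x : X) : 'rV[AG]_#|X| := delta_mx 0 (enum_rank x).

Definition pres_boundary : 'rV[AG]_#|X| -> AG^o :=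
  lincomb (fun i => ([1, cls [:: (enum_val i, true)]] - 1 : AG^o)).
HB.instance Definition _ := GRing.Linear.on pres_boundary.

Definition pres_augmentation : AG^o -> trivial_module A (presented S) :=
  scale_at (1 : trivial_module A (presented S)).
HB.instance Definition _ := GRing.Linear.on pres_augmentation.

Lemma pres_boundary_gen x :
  pres_boundary (pres_gen x) = [1, cls [:: (x, true)]] - 1.
Proof. by rewrite [LHS]lincomb_delta enum_rankK. Qed.

Lemma pres_gen_span q : span (range pres_gen) q.
Proof.
rewrite -[q]lincomb_id; apply: span_sum => i; apply/spanZ/sub_span.
by exists (enum_val i) => //; rewrite /pres_gen enum_valK.
Qed.

Lemma pres_augmentationE x : pres_augmentation x = augmentation x.
Proof. exact: mulr1. Qed.

Lemma pres_augmentation_surj a : exists x, pres_augmentation x = a.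
Proof. by exists [a, 1%g]; rewrite pres_augmentationE augmentationU. Qed.

Lemma pres_exact_augmentation : exact_at pres_boundary pres_augmentation.
Proof.
move=> x /=; split=> [|[q <-]].
  rewrite pres_augmentationE => aug0; exists (fox_lift pres_gen x).
  rewrite (boundary_fox_lift pres_boundary_gen) aug0.
  by rewrite /gr_single monalgU0 subr0.
rewrite /pres_boundary /lincomb linear_sum big1 // => i _.
set y := enum_val i; rewrite linearZ /= pres_augmentationE.
have -> : augmentation ([1, cls [:: (y, true)]] - 1) = 0 :> A.
  have := augmentationD ([1, cls [:: (y, true)]] - 1) 1.
  rewrite subrK augmentation1 augmentationU => /(canLR (addrK _)) <-.
  exact: subrr.
by rewrite scaler0.
Qed.

Lemma type_FP2_of_finite_span (L : seq (word X)) :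
    (forall w, w \in L -> S w) ->
    (forall w, S w -> span (fox pres_gen @` [set` L]) (fox pres_gen w)) ->
  type_FP 2 A (presented S).
Proof.
move=> LS S_L.
pose P (i : nat) : lmodType AG := match i with
  | 0%N => AG^o | 1%N => 'rV[AG]_#|X| | _ => 'rV[AG]_(size L) end.
pose d (i : nat) : {linear P i.+1 -> P i} := match i with
  | 0%N => pres_boundary
  | 1%N => lincomb (fun j => fox pres_gen (tnth (in_tuple L) j))
  | _ => lincomb (fun=> 0) end.
exists P, d, pres_augmentation; split=> [||_|].
- case=> [|[|i]] _ /=.
  + by split; [exact: regular_finitely_generated | exact: regular_projective].
  + by split; [exact: free_finitely_generated | exact: free_projective].
  + by split; [exact: free_finitely_generated | exact: free_projective].
- exact: pres_augmentation_surj.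
- exact: pres_exact_augmentation.
case=> // _ q; split=> [bq0 | [c <-]].
- apply/span_lincomb.
  apply: span_sub (ker_boundary pres_boundary_gen pres_gen_span bq0).
  move=> _ [w Sw <-]; apply: span_sub (S_L w Sw) => _ [u uL <-].
  have [j ->] := tnthP (in_tuple L) _ uL.
  by apply: sub_span; exists j.
- rewrite linear_sum big1 // => j _; rewrite linearZ /=.
  rewrite (boundary_fox pres_boundary_gen).
  have -> : cls (tnth (in_tuple L) j) = 1%g.
    by apply/pres_classP/pres_relator/LS/mem_tnth.
  by rewrite gr_single1 subrr scaler0.
Qed.

Lemma finite_span_of_type_FP2 : type_FP 2 A (presented S) ->
  exists L : seq (word X), (forall w, w \in L -> S w) /\
    forall w, S w -> span (fox pres_gen @` [set` L]) (fox pres_gen w).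
Proof.
move=> [P [d [eps [fgP eps_surj ex0 ex1]]]].
have [[fg0 pr0] [fg1 pr1]] := (fgP 0%N isT, fgP 1%N isT).
have [fg2 _] := fgP 2%N isT.
have [s [s_ker s_gen]] := kernel_finitely_generated fg2 fg1 pr1 fg0 pr0
  (@free_finitely_generated _ _) (@free_projective _ _)
  (@regular_finitely_generated _) (@regular_projective _)
  (ex1 0%N isT) (ex0 isT) pres_exact_augmentation
  eps_surj pres_augmentation_surj.
have [L [LS Ls]] := span_image_finite
  (fun v vs => ker_boundary pres_boundary_gen pres_gen_span (s_ker v vs)).
exists L; split=> // w Sw; apply: span_sub (s_gen _ _) => //.
rewrite (boundary_fox pres_boundary_gen).
have -> : cls w = 1%g by apply/pres_classP/pres_relator.
by rewrite gr_single1 subrr.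
Qed.
End Criterion.

(** * Detecting relators by cocycles *)

Definition int_multiple (A : nzRingType) (n : int) (a : A) : A := a * n%:~R.

Lemma int_multipleB (A : nzRingType) (n : int) (a b : A) :
  int_multiple n (a - b) = int_multiple n a - int_multiple n b.
Proof. exact: mulrBl. Qed.

HB.instance Definition _ (A : nzRingType) (n : int) :=
  GRing.isZmodMorphism.Build A A (int_multiple n) (@int_multipleB A n).

Section CocycleDetection.
Variables (X : finType) (A : nzRingType) (S : set (word X)).
Notation AG := (group_ring A (presented S)).
Local Notation "[ a , g ]" := (@gr_single A (presented S) a g).
Local Notation cls := (@pres_class X S).
Local Notation phi := (fox (pres_gen A S)).

Section Weight.
Variable tau : presented S -> word X -> int.

(** An integer valued cocycle defines a functional on the free module, sending
    the Fox derivative of a word to its value on that word. *)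
Definition cocycle_weight (q : 'rV[AG]_#|X|) : A :=
  \sum_i gr_extension (fun g => int_multiple (tau g [:: (enum_val i, true)]))
    (q 0 i).

Lemma cocycle_weightB p q :
  cocycle_weight (p - q) = cocycle_weight p - cocycle_weight q.
Proof. by rewrite -sumrB; apply: eq_bigr => i _; rewrite !mxE raddfB. Qed.

HB.instance Definition _ :=
  GRing.isZmodMorphism.Build 'rV[AG]_#|X| A cocycle_weight cocycle_weightB.

Hypothesis tau_cat :
  forall g u v, tau g (u ++ v) = tau g u + tau (g * cls u)%g v.
Hypothesis tau_cancel : forall g l, tau g [:: l; inv_letter l] = 0.

Lemma cocycle_weight_gen a g x :
  cocycle_weight ([a, g] *: pres_gen A S x) = a * (tau g [:: (x, true)])%:~R.
Proof.
rewrite /cocycle_weight (bigD1 (enum_rank x)) //= big1 ?addr0 => [|i ix].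
  by rewrite !mxE !eqxx mulr1 gr_extension_single /= enum_rankK.
by rewrite !mxE (negPf ix) mulr0 raddf0.
Qed.

Lemma cocycle_weight_fox a g w :
  cocycle_weight ([a, g] *: phi w) = a * (tau g w)%:~R.
Proof.
elim: w g => [|l w IHw] g /=.
  have := tau_cat g [::] [::]; rewrite /= mulg1 => /(canLR (addrK _)).
  by rewrite subrr => <-; rewrite scaler0 raddf0 mulr0.
rewrite scalerDr raddfD /= scalerA gr_singleM mulr1 IHw.
rewrite (tau_cat g [:: l] w : tau g (l :: w) = _) rmorphD mulrDr.
congr (_ + _); case: l => x [] /=; rewrite /fox_letter /=.
  exact: cocycle_weight_gen.
rewrite scalerN raddfN scalerA gr_singleM mulr1 /= cocycle_weight_gen.
have := tau_cat g [:: (x, false)] [:: (x, true)].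
rewrite (tau_cancel g (x, false)) => /esym/eqP; rewrite addr_eq0 => /eqP->.
by rewrite rmorphN mulrN.
Qed.
End Weight.

(** The integer [tau g w] is to be thought of as a fixed functional applied to
    the translate by [g] of the value at [w] of a derivation.
    If finitely many Fox derivatives spanned all of them, the functional of a
    cocycle that vanishes on these finitely many relators would vanish on [r],
    so that 1 = 0 in [A]. *)
Lemma cocycle_not_type_FP2 :
    (forall L : seq (word X), (forall w, w \in L -> S w) ->
      exists r (tau : presented S -> word X -> int),
      [/\ S r, forall g u v, tau g (u ++ v) = tau g u + tau (g * cls u)%g v,
          forall g l, tau g [:: l; inv_letter l] = 0,
          forall g w, w \in L -> tau g w = 0 & tau 1%g r = 1]) ->
  ~ type_FP 2 A (presented S).
Proof.
move=> detect /finite_span_of_type_FP2[L [LS L_span]].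
have [r [tau [Sr tau_cat tau_cancel tau_L tau_r]]] := detect L LS.
have main := cocycle_weight_fox tau_cat tau_cancel.
suff : cocycle_weight tau (phi r) = 0.
  rewrite -[phi r]scale1r -gr_single1 main tau_r mulr1 => /eqP.
  by rewrite oner_eq0.
have [s [sL ->]] := L_span r Sr; rewrite raddf_sum big_seq big1 // => p ps.
have [w wL <-] := sL p ps.
rewrite [p.1]gr_expand scaler_suml raddf_sum big1 // => g _.
by rewrite /= main tau_L // mulr0.
Qed.
End CocycleDetection.

(** * The presentation *)

Definition generator : finType := (bool + colour * 'I_6 * 'I_6)%type.

Definition gen_s : word generator := [:: (inl true, true)].
Definition gen_t : word generator := [:: (inl false, true)].
Definition gen_x (c : colour) (i j : 'I_6) : word generator :=
  [:: (inr (c, i, j), true)].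

Definition sub_colour (c d : colour) := join c d == d.

Definition conj_word (u v : word generator) : word generator :=
  u ++ v ++ inv_word u.

(** The letters of a colour set are to be invariant under s, t or s^-1 t when
    their idempotent is constant along the corresponding direction. *)
Inductive base_relator : word generator -> Prop :=
| rel_st : base_relator (commutator_word gen_s gen_t)
| rel_t c i j : sub_colour c (true, false, false) ->
    base_relator (commutator_word (gen_x c i j) gen_t)
| rel_s c i j : sub_colour c (false, true, false) ->
    base_relator (commutator_word (gen_x c i j) gen_s)
| rel_sVt c i j : sub_colour c (false, false, true) ->
    base_relator (commutator_word (gen_x c i j) (inv_word gen_s ++ gen_t))
| rel_commuting c d i j k l : join c d != full -> i != ord0 -> k != ord0 ->
    i != j -> k != l -> i != l -> j != k ->
    base_relator (commutator_word (gen_x c i j) (gen_x d k l))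
| rel_composing c d i j l : join c d != full -> i != ord0 -> j != ord0 ->
    i != j -> j != l -> i != l ->
    base_relator (commutator_word (gen_x c i j) (gen_x d j l) ++
                  inv_word (gen_x (join c d) i l)).

Definition level_word (n : nat) (i k j : 'I_6) : word generator :=
  commutator_word (gen_x (true, false, false) i k)
    (conj_word (nseq n (inl true, true)) (gen_x (false, true, true) k j)).

Inductive level_relator (n : nat) : word generator -> Prop :=
| rel_level i k j : i != ord0 -> k != ord0 -> i != k -> k != j -> i != j ->
    level_relator n (level_word n i k j).

Definition all_relators : set (word generator) :=
  [set w | base_relator w \/ exists n, level_relator n w].

Section BaseGroup.
Local Notation H := (presented base_relator).
Local Notation cls := (@pres_class generator base_relator).
Local Open Scope group_scope.
Let s : H := cls gen_s.
Let t : H := cls gen_t.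
Let x c i j : H := cls (gen_x c i j).

Lemma base_relatorE w : base_relator w -> cls w = 1.
Proof. by move=> rw; apply/pres_classP/pres_relator. Qed.

Lemma commute_relator u v :
  base_relator (commutator_word u v) -> commute (cls u) (cls v).
Proof.
by move=> /base_relatorE; rewrite pres_class_commutator => /eqP/commgP.
Qed.

Definition level_shift (n : nat) (c : colour) : H :=
  if c.2 then if c.1.1 then t ^- n else s ^- n else 1.

Definition level_family (n : nat) (c : colour) (i j : 'I_6) : H :=
  x c i j ^ level_shift n c.

Lemma conj_fixed (G : groupType) (u v : G) n : commute u v -> u ^ (v ^- n) = u.
Proof.
move=> uv; apply/conjg_fixP; apply/commgP/commuteV; exact: commuteX.
Qed.

(** Two families that miss a common colour are shifted by a common element: 1
    if the colour c is missing, s^-n if a is, and t^-n if b is. *)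
Lemma level_shift_common n (J : colour) : J != full ->
  exists z, forall c i j, sub_colour c J -> level_family n c i j = x c i j ^ z.
Proof.
have xt c i j : sub_colour c (true, false, false) ->
    x c i j ^ (t ^- n) = x c i j.
  by move=> c_a; apply/conj_fixed/commute_relator/rel_t.
have xs c i j : sub_colour c (false, true, false) ->
    x c i j ^ (s ^- n) = x c i j.
  by move=> c_b; apply/conj_fixed/commute_relator/rel_s.
(* s^n = t^n (s^-1 t)^-n, and the last factor acts trivially. *)
have xst c i j : sub_colour c (false, false, true) ->
    x c i j ^ (s ^- n) = x c i j ^ (t ^- n).
  move=> c_c; have xst : commute (x c i j) (s^-1 * t).
    rewrite /s -pres_class_inv /t -pres_class_catg.
    exact/commute_relator/rel_sVt.
  have st : commute s t by apply/commute_relator/rel_st.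
  have : x c i j ^ (s^-1 * t) ^- n = x c i j by apply: conj_fixed.
  rewrite expgMn; last exact/commute_sym/commuteV/commute_sym.
  rewrite invgM expVgn invgK => {1}<-.
  by rewrite -!conjgM mulgK.
rewrite /level_family /level_shift /sub_colour.
case: J => [[[] []] []] // _.
- by exists 1 => -[[[] []] []].
- by exists (t ^- n) => -[[[] []] []] i j //= _;
    [rewrite conjg1 xt | rewrite xst | rewrite conjg1 xt].
- by exists 1 => -[[[] []] []].
- by exists (s ^- n) => -[[[] []] []] i j //= _; rewrite conjg1 xs.
- by exists 1 => -[[[] []] []].
- by exists (s ^- n) => -[[[] []] []] i j //= _; rewrite conjg1 xs.
- by exists 1 => -[[[] []] []].
Qed.

Lemma join_sub c d : sub_colour c (join c d) /\ sub_colour d (join c d).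
Proof. by case: c d => [[[] []] []] [[[] []] []]. Qed.

Lemma level_family_commuting n c d : join c d != full ->
  commuting (level_family n c) (level_family n d).
Proof.
move=> cd i j k l i0 k0 ij kl il jk.
have [z z_c] := level_shift_common n cd; have [c_cd d_cd] := join_sub c d.
rewrite !z_c //; apply/commgP; rewrite -conjRg conjg_eq1; apply/commgP.
exact/commute_relator/rel_commuting.
Qed.

Lemma level_family_composing n c d : join c d != full ->
  composing (level_family n c) (level_family n d) (level_family n (join c d)).
Proof.
move=> cd i j l i0 j0 ij jl il.
have [z z_c] := level_shift_common n cd; have [c_cd d_cd] := join_sub c d.
rewrite !z_c ?/sub_colour //; last first.
  by case: (c) (d) => [[[] []] []] [[[] []] []].
rewrite -conjRg; congr (_ ^ _); apply/divg1_eq.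
rewrite /x -pres_class_commutator -pres_class_inv -pres_class_catg.
exact/base_relatorE/rel_composing.
Qed.

Lemma level_wordE n i k j : cls (level_word n i k j) =
  [~ level_family n (true, false, false) i k,
     level_family n (false, true, true) k j].
Proof.
rewrite pres_class_commutator /conj_word !pres_class_catg pres_class_inv.
have -> : cls (nseq n (inl true, true)) = s ^+ n.
  elim: n => //= n IHn; rewrite expgS -IHn; exact: pres_class_cons.
by rewrite /level_family /level_shift /= conjg1 /conjg invgK mulgA.
Qed.

(** The level words multiply like elementary matrices over an idempotent, so
    each of them is the commutator of two others of the same level. *)
Lemma level_word_commutator n w : level_relator n w ->
  exists u v, [/\ level_relator n u, level_relator n v &
    pres_eq base_relator w (commutator_word u v)].
Proof.
case=> i k j i0 k0 ik kj ij.
have [q [qE qq]] := full_family_perfect (@level_family_commuting n)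
  (@level_family_composing n).
have [l] := @fresh_index [:: ord0; i; j] isT.
rewrite !inE !negb_or => /and3P[l0 li lj].
have [p] := @fresh_index [:: ord0; i; j; l] isT.
rewrite !inE !negb_or => /and4P[p0 pi pj pl].
have [il ip lp] : [/\ i != l, i != p & l != p] by split; rewrite eq_sym.
exists (level_word n i p l), (level_word n l p j); split.
- exact: rel_level.
- exact: rel_level.
apply/(pres_classP base_relator); rewrite pres_class_commutator !level_wordE.
by rewrite !qE ?qq.
Qed.
End BaseGroup.

(** * Type FP_2 for the full presentation *)

Lemma base_relator_finite : exists L : seq (word generator),
  forall w, w \in L <-> base_relator w.
Proof.
pose T3 := (colour * 'I_6 * 'I_6)%type.
pose x3 (p : T3) := gen_x p.1.1 p.1.2 p.2.
pose big := commutator_word gen_s gen_t ::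
  codom (fun p : T3 => commutator_word (x3 p) gen_t) ++
  codom (fun p : T3 => commutator_word (x3 p) gen_s) ++
  codom (fun p : T3 => commutator_word (x3 p) (inv_word gen_s ++ gen_t)) ++
  codom (fun p : T3 * T3 => commutator_word (x3 p.1) (x3 p.2)) ++
  codom (fun p : T3 * T3 => commutator_word (x3 p.1) (x3 p.2) ++
    inv_word (gen_x (join p.1.1.1 p.2.1.1) p.1.1.2 p.2.2)).
exists [seq w <- big | `[< base_relator w >]] => w; rewrite mem_filter.
split=> [/andP[/asboolP] // | rw]; apply/andP; split; first exact/asboolP.
rewrite inE !mem_cat.
case: {w} rw => [|c i j _|c i j _|c i j _|c d i j k l *|c d i j l *].
- by rewrite eqxx.
- by rewrite (codom_f (fun p : T3 => commutator_word (x3 p) gen_t)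
    (c, i, j)) !orbT.
- by rewrite (codom_f (fun p : T3 => commutator_word (x3 p) gen_s)
    (c, i, j)) !orbT.
- by rewrite (codom_f (fun p : T3 =>
    commutator_word (x3 p) (inv_word gen_s ++ gen_t)) (c, i, j)) !orbT.
- by rewrite (codom_f (fun p : T3 * T3 => commutator_word (x3 p.1) (x3 p.2))
    ((c, i, j), (d, k, l))) !orbT.
- by rewrite (codom_f (fun p : T3 * T3 => commutator_word (x3 p.1) (x3 p.2) ++
    inv_word (gen_x (join p.1.1.1 p.2.1.1) p.1.1.2 p.2.2))
    ((c, i, j), (d, j, l))) !orbT.
Qed.

(** The base relators suffice to span: by [level_word_commutator] any other
    relator equals, modulo base relators, a commutator of relators. *)
Lemma all_relators_type_FP2 (A : nzRingType) :
  type_FP 2 A (presented all_relators).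
Proof.
have [L L_base] := base_relator_finite.
apply: (@type_FP2_of_finite_span _ _ _ L) => [w /L_base | w]; first by left.
set phi := fox _.
have phiL u : base_relator u -> span (phi @` [set` L]) (phi u).
  by move=> /L_base uL; apply: sub_span; exists u.
case=> [/phiL // | [n lw]].
have [u [v [lu lv wuv]]] := level_word_commutator lw.
have one y : level_relator n y -> pres_class all_relators y = 1%g.
  by move=> ly; apply/pres_classP/pres_relator; right; exists n.
have -> : phi w = phi w - phi (commutator_word u v).
  by rewrite /phi fox_commutator ?subr0 //; apply: one.
have base_all : (base_relator : set (word generator)) `<=` all_relators by left.
apply: span_sub (fox_pres_eq _ base_all wuv) => _ [y ry <-]; exact: phiL.
Qed.

(** * An action on configurations over the plane *)

(** At each point of the plane there is a column vector, on which the elementary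
    matrices act. *)
Definition config := int -> int -> 'I_6 -> int.
Implicit Types (F : config) (D : int -> int -> bool).

(** The identity when (i, j) is not the position of an off-diagonal entry in a
    row other than 0. *)
Definition elementary D (i j : 'I_6) (c : int) F : config := fun x y k =>
  F x y k + (if [&& D x y, k == i, i != ord0 & i != j] then c * F x y j else 0).

Definition translate (dx dy : int) F : config := fun x y => F (x - dx) (y - dy).

(** The idempotents attached to the colours are the indicator functions of three
    lines; a set of colours gives the intersection of its lines. *)
Definition flat (m : nat) (c : colour) (x y : int) : bool :=
  [&& c.1.1 ==> (x == 0), c.1.2 ==> (y == 0) & c.2 ==> (x + y == - m%:Z)].

Definition act_letter (m : nat) (l : generator * bool) : config -> config :=
  let e : int := if l.2 then 1 else -1 in
  match l.1 with
  | inl true => translate e 0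
  | inl false => translate 0 e
  | inr (c, i, j) => elementary (flat m c) i j e
  end.

Definition act (m : nat) (w : word generator) F : config :=
  foldr (act_letter m) F w.

Lemma config_ext F F' : (forall x y k, F x y k = F' x y k) -> F = F'.
Proof.
by move=> FF'; apply/funext => x; apply/funext => y; apply/funext => k.
Qed.

Lemma act_cat m u v F : act m (u ++ v) F = act m u (act m v F).
Proof. exact: foldr_cat. Qed.

Lemma act_letterK m l F : act_letter m l (act_letter m (inv_letter l) F) = F.
Proof.
apply: config_ext => x y k.
case: l => -[[]|[[c i] j]] b; rewrite /act_letter /=.
- by rewrite /translate !subr0; case: b; rewrite /= ?opprK ?addrK ?subrK.
- by rewrite /translate !subr0; case: b; rewrite /= ?opprK ?addrK ?subrK.
rewrite /elementary; case: ifP => [/and4P[_ _ _ ij]|_]; last by rewrite !addr0.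
rewrite [j == i]eq_sym (negPf ij) /= andbF addr0.
by case: b; rewrite /= ?mulN1r ?mul1r ?subrK ?addrK.
Qed.

Lemma inv_wordK (X : choiceType) (w : word X) : inv_word (inv_word w) = w.
Proof.
rewrite /inv_word map_rev revK -map_comp map_id_in // => -[x b] _.
by rewrite /= /inv_letter /= negbK.
Qed.

Lemma act_inv m w F : act m w (act m (inv_word w) F) = F.
Proof.
elim: w F => // l w IHw F; rewrite /inv_word /= rev_cons -cats1 -/(inv_word w).
by rewrite act_cat IHw act_letterK.
Qed.

Lemma act_invK m w F : act m (inv_word w) (act m w F) = F.
Proof. by rewrite -{2}[w]inv_wordK act_inv. Qed.

Lemma act_commutator m u v (h : config -> config) :
    (forall F, act m u (act m v F) = act m v (act m u (h F))) ->
  forall F, act m (commutator_word u v) F = h F.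
Proof. by move=> uv F; rewrite !act_cat uv !act_invK. Qed.

Lemma elementary_other D i j c F x y k : k != i ->
  elementary D i j c F x y k = F x y k.
Proof. by rewrite /elementary => /negPf->; rewrite andbF addr0. Qed.

Lemma elementaryE D i j c F x y k : elementary D i j c F x y k =
  F x y k + (if [&& D x y, k == i, i != ord0 & i != j] then c * F x y j else 0).
Proof. by []. Qed.

Lemma elementary_commute D D' i j k l F : i != l -> j != k ->
  elementary D i j 1 (elementary D' k l 1 F) =
  elementary D' k l 1 (elementary D i j 1 F).
Proof.
move=> il jk; apply: config_ext => x y z.
rewrite [LHS]elementaryE [RHS]elementaryE [X in X + _]elementaryE.
rewrite (elementary_other _ _ _ _ _ _ jk) [X in _ = X + _]elementaryE.
by rewrite [elementary D i j 1 F x y l]elementary_other 1?eq_sym // addrAC.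
Qed.

Lemma elementary_compose D D' i j l F :
    i != ord0 -> j != ord0 -> i != j -> j != l -> i != l ->
  elementary D i j 1 (elementary D' j l 1 F) =
  elementary D' j l 1 (elementary D i j 1
    (elementary (fun x y => D x y && D' x y) i l 1 F)).
Proof.
move=> i0 j0 ij jl il.
have [ji li] : j != i /\ l != i by rewrite ![_ == i]eq_sym.
apply: config_ext => x y z.
rewrite [LHS]elementaryE [RHS]elementaryE.
rewrite [elementary D' j l 1 F x y z]elementaryE.
rewrite [elementary D' j l 1 F x y j]elementaryE.
rewrite [elementary D i j 1 _ x y z]elementaryE.
rewrite [elementary D i j 1 _ x y l]elementary_other //.
rewrite [elementary _ i l 1 F x y z]elementaryE.
rewrite ![elementary _ i l 1 F x y _]elementary_other //.
rewrite i0 j0 ij jl il eqxx !andbT !mul1r -!addrA; congr (_ + _).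
have [->|zi] := eqVneq z i; last by rewrite !andbF !add0r addr0.
rewrite (negPf ij) !andbF !andbT !add0r addr0.
by case: (D x y) (D' x y) => [] []; rewrite /= ?addr0 ?add0r // addrC.
Qed.

Lemma elementary_idle (D : int -> int -> bool) i j c F :
  (forall x y, D x y = false) -> elementary D i j c F = F.
Proof.
by move=> D0; apply: config_ext => x y k; rewrite elementaryE D0 addr0.
Qed.

Lemma translateD a b a' b' F :
  translate a b (translate a' b' F) = translate (a + a') (b + b') F.
Proof. by apply: config_ext => x y k; rewrite /translate !opprD !addrA. Qed.

Lemma translate_elementary a b D i j c F :
  translate a b (elementary D i j c F) =
  elementary (fun x y => D (x - a) (y - b)) i j c (translate a b F).
Proof. by []. Qed.

Lemma act_s m F : act m gen_s F = translate 1 0 F.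
Proof. by []. Qed.

Lemma act_t m F : act m gen_t F = translate 0 1 F.
Proof. by []. Qed.

Lemma act_sVt m F : act m (inv_word gen_s ++ gen_t) F = translate (-1) 1 F.
Proof. by rewrite act_cat act_t [LHS]translateD addr0 add0r. Qed.

Lemma act_x m c i j F : act m (gen_x c i j) F = elementary (flat m c) i j 1 F.
Proof. by []. Qed.

Lemma flat_join m c d x y :
  flat m (join c d) x y = flat m c x y && flat m d x y.
Proof.
rewrite /flat; case: c d => [[c1 c2] c3] [[d1 d2] d3] /=.
by case: (x == 0) (y == 0) (x + y == _) => [] [] []; case: c1 c2 c3 d1 d2 d3
  => [] [] [] [] [] [].
Qed.

Lemma act_base m w F : base_relator w -> act m w F = F.
Proof.
have id_comm u v : (forall F, act m u (act m v F) = act m v (act m u F)) ->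
    act m (commutator_word u v) F = F.
  by move=> uv; rewrite (@act_commutator m u v id).
have translate_x a b c i j G :
    (forall x y, flat m c (x - a) (y - b) = flat m c x y) ->
    elementary (flat m c) i j 1 (translate a b G) =
    translate a b (elementary (flat m c) i j 1 G).
  move=> flat_inv; rewrite translate_elementary; congr elementary.
  by apply/funext => x; apply/funext => y.
case=> [|c i j c_a|c i j c_b|c i j c_c|c d i j k l _ i0 k0 ij kl il jk|].
- by apply: id_comm => G; rewrite !act_s !act_t !translateD !addr0 !add0r.
- apply: id_comm => G; rewrite !act_t !act_x; apply: translate_x => x y.
  by case: c c_a => [[[] []] []] //; rewrite /flat /= subr0.
- apply: id_comm => G; rewrite !act_s !act_x; apply: translate_x => x y.
  by case: c c_b => [[[] []] []] //; rewrite /flat /= subr0.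
- apply: id_comm => G; rewrite !act_sVt !act_x; apply: translate_x => x y.
  case: c c_c => [[[] []] []] //; rewrite /flat /=.
  by rewrite opprK addrACA subrr addr0.
- by apply: id_comm => G; apply: elementary_commute.
- move=> c d i j l _ i0 j0 ij jl il; rewrite act_cat.
  rewrite (@act_commutator m _ _ (act m (gen_x (join c d) i l))) ?act_inv //.
  move=> G; rewrite !act_x elementary_compose //.
  congr (elementary _ _ _ _ (elementary _ _ _ _ _)).
  congr elementary; apply/funext => x; apply/funext => y; exact/esym/flat_join.
Qed.

(** The conjugation by s^n moves the line of the third colour to x + y = n - m,
    which passes through the intersection of the two others only if n = m. *)
Lemma act_level m n i k j F :
    i != ord0 -> k != ord0 -> i != k -> k != j -> i != j ->
  act m (level_word n i k j) F =
  elementary (fun x y => [&& x == 0, y == 0 & n == m]) i j 1 F.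
Proof.
move=> i0 k0 ik kj ij.
have act_sn G : act m (nseq n (inl true, true)) G = translate n%:Z 0 G.
  elim: n => [|n' IHn].
    by apply: config_ext => x y z; rewrite /translate !subr0.
  rewrite -[LHS]/(translate 1 0 (act m (nseq n' _) G)) IHn translateD.
  by rewrite addr0 intS.
pose bc : colour := (false, true, true).
have act_conj G :
    act m (conj_word (nseq n (inl true, true)) (gen_x bc k j)) G =
    elementary (fun x y => flat m bc (x - n%:Z) (y - 0)) k j 1 G.
  by rewrite !act_cat act_x act_sn translate_elementary -act_sn act_inv.
apply: act_commutator => G; rewrite !act_conj !act_x elementary_compose //.
congr (elementary _ _ _ _ (elementary _ _ _ _ (elementary _ _ _ _ _))).
apply/funext => x; apply/funext => y; rewrite /flat /= subr0 !andbT.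
have [->|//] := eqVneq x 0; have [->|] := eqVneq y 0; last by rewrite andbF.
by rewrite addr0 sub0r eqr_opp eqz_nat.
Qed.

Definition config_sub (F G : config) : config := fun x y k => F x y k - G x y k.

(** Column 0 is fixed by the action: value 0 there defines an invariant module,
    and value 1 an affine space over it. *)
Definition const_column (c : int) (F : config) := forall x y, F x y ord0 = c.

Definition unit_column : config := fun _ _ k => if k == ord0 then 1 else 0.

Lemma act_sub m w F G :
  act m w (config_sub F G) = config_sub (act m w F) (act m w G).
Proof.
elim: w => //= l w ->; apply: config_ext => x y k; rewrite /config_sub.
case: l => -[[]|[[c i] j]] b //=; rewrite /act_letter /= /elementary.
by case: ifP => _; rewrite ?subr0 ?addr0 // mulrBr opprD addrACA.
Qed.

Lemma act_const_column m w c F : const_column c F -> const_column c (act m w F).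
Proof.
move=> Fc; elim: w => // l w.
rewrite [act m (_ :: _) F]/(act_letter m l (act m w F)).
move: (act m w F) => G Gc x y.
case: l => -[[]|[[d i] j]] b; [exact: Gc | exact: Gc |].
rewrite [LHS]elementaryE Gc [ord0 == i]eq_sym.
by case: (i == ord0); rewrite ?andbF addr0.
Qed.

Lemma act_pres_eq m (S : set (word generator)) u v :
    (forall r F, S r -> const_column 0 F -> act m r F = F) ->
  pres_eq S u v -> forall F, const_column 0 F -> act m u F = act m v F.
Proof.
move=> S_fix; elim=> {u v}
  [u|u v _ IH|v u w _ IH1 _ IH2|u u' v v' _ IH1 _ IH2|l|r Sr] F F0 //.
- by rewrite IH.
- by rewrite IH1 ?IH2.
- by rewrite !act_cat IH2 // IH1 //; apply: act_const_column.
- exact: act_letterK.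
- exact: S_fix.
Qed.

(** * Quotients that are not of type FP_2 *)

(** An entry in column 0, hence in the abelian normal part of its level: it acts
    trivially on configurations that vanish in column 0. *)
Definition target (n : nat) : word generator :=
  level_word n (inord 1) (inord 2) ord0.

Lemma target_index : [/\ inord 1 != ord0 :> 'I_6, inord 2 != ord0 :> 'I_6 &
  inord 1 != inord 2 :> 'I_6].
Proof. by rewrite -!val_eqE /= !inordK. Qed.

Lemma target_level n : level_relator n (target n).
Proof. by have [i0 k0 ik] := target_index; exact: rel_level. Qed.

Lemma act_target m n F : act m (target n) F =
  elementary (fun x y => [&& x == 0, y == 0 & n == m]) (inord 1) ord0 1 F.
Proof. by have [i0 k0 ik] := target_index; exact: act_level. Qed.

Lemma act_level_fixed m n w F : level_relator n w -> n != m -> act m w F = F.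
Proof.
case=> i k j i0 k0 ik kj ij /negPf nm; rewrite act_level //.
by apply: elementary_idle => x y; rewrite nm !andbF.
Qed.

Lemma level_bound (L : seq (word generator)) :
    (forall w, w \in L -> all_relators w) ->
  exists m, forall F w, w \in L -> act m w F = F.
Proof.
move=> L_all; suff [m m_L] : exists m, forall w, w \in L ->
    base_relator w \/ exists2 n, (n < m)%N & level_relator n w.
  exists m => F w /m_L[/act_base // | [n nm lw]].
  by apply: act_level_fixed lw _; rewrite ltn_eqF.
elim: L L_all => [|w L IHL] L_all; first by exists 0%N.
have [m m_L] := IHL (fun u uL => L_all u (mem_behead (s := w :: L) uL)).
have [bw | [n lw]] := L_all w (mem_head _ _).
  by exists m => u; rewrite inE => /predU1P[-> | /m_L //]; left.
exists (maxn n.+1 m) => u; rewrite inE => /predU1P[-> | /m_L[|[n' n'm lu]]].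
- by right; exists n; rewrite ?leq_max ?leqnn.
- by left.
- by right; exists n'; rewrite ?leq_max ?n'm ?orbT.
Qed.

(** All these relators act trivially on configurations that vanish in column 0,
    hence the presented group acts on them, and the displacement of
    [unit_column] is a derivation with values in them; its entry at the origin
    is the cocycle. *)
Lemma intermediate_not_type_FP2 (T : seq (word generator)) (A : nzRingType) :
    (forall w, w \in T -> all_relators w) ->
  ~ type_FP 2 A (presented
      [set w | [\/ w \in T, base_relator w | exists n, w = target n]]).
Proof.
set S := [set w | _] => T_all; apply: cocycle_not_type_FP2 => L LS.
have S_all w : S w -> all_relators w.
  case=> [/T_all // | bw | [n ->]]; first by left.
  by right; exists n; exact: target_level.
have [m m_TL] : exists m, forall F w, w \in T ++ L -> act m w F = F.
  by apply: level_bound => w; rewrite mem_cat => /orP[/T_all | /LS/S_all].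
have S_fix r F : S r -> const_column 0 F -> act m r F = F.
  case=> [rT | br | [n ->]] F0; first by apply: m_TL; rewrite mem_cat rT.
    exact: act_base.
  apply: config_ext => x y k.
  by rewrite act_target elementaryE F0 mulr0 if_same addr0.
pose disp w := config_sub (act m w unit_column) unit_column.
have disp0 w : const_column 0 (disp w).
  have unit1 : const_column 1 unit_column by [].
  move=> x y; rewrite /disp /config_sub.
  by rewrite (act_const_column m w unit1) unit1 subrr.
(* Representatives of g act in the same way on displacements, which vanish in
   column 0; they need not on [unit_column]. *)
pose tau (g : presented S) w := act m (pres_repr g) (disp w) 0 0 (inord 1).
exists (target m), tau; split.
- by constructor 3; exists m.
- move=> g u v; rewrite /tau.
  rewrite (@act_pres_eq _ S (pres_repr (g * pres_class S u)%g)
    (pres_repr g ++ u)) //; last first.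
    by apply/(pres_classP S); rewrite pres_class_catg !pres_reprK.
  by rewrite /disp !act_cat !act_sub /config_sub [RHS]addrC subrKA.
- move=> g l; rewrite /tau /disp /= act_letterK.
  by rewrite act_sub /config_sub subrr.
- move=> g w wL; rewrite /tau /disp (m_TL _ w) ?mem_cat ?wL ?orbT //.
  by rewrite act_sub /config_sub subrr.
- rewrite /tau (act_pres_eq S_fix (pres_reprE S [::])) //= /disp /config_sub.
  have [i0 _ _] := target_index.
  rewrite act_target elementaryE /unit_column !eqxx i0 (negPf i0).
  by rewrite add0r subr0.
Qed.

Local Close Scope ring_scope.

Theorem theorem5p3 :
  exists (X : finType) (R : set (word X)),
    type_FP 2 int (presented R) /\
    forall T : set (word X), finite_set T -> T `<=` R ->
      exists S : set (word X),
        [/\ T `<=` S, S `<=` R &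
            forall A : nzRingType, ~ type_FP 2 A (presented S)].
Proof.
exists generator, all_relators; split=> [|T finT TR];
  first exact: all_relators_type_FP2.
have /finite_seqP[s sT] := finT; rewrite sT in TR *.
exists [set w | [\/ w \in s, base_relator w | exists n, w = target n]]; split.
- by move=> w ws; constructor 1.
- move=> w [ws | bw | [n ->]]; [exact: TR | by left|].
  by right; exists n; exact: target_level.
- by move=> A; apply: intermediate_not_type_FP2.
Qed.
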